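(* Let $(L,\cdot,[-,-,-],\varepsilon)$ and $(L',\cdot',[-,-,-]',\varepsilon)$ be two non-commutative ternary Leibniz-Nambu-Poisson color algebras and $\alpha:L\to L'$ a morphism of non-commutative ternary Leibniz-Nambu-Poisson color algebras. Define $$x\ast m=\alpha(x)\cdot' m,\qquad m\ast x=m\cdot'\alpha(x),$$ $$\{m,x,y\}=[m,\alpha(x),\alpha(y)]',\quad \{x,m,y\}=[\alpha(x),m,\alpha(y)]',\quad \{x,y,m\}=[\alpha(x),\alpha(y),m]',$$ for $x,y\in\mathcal{H}(L)$ and $m\in\mathcal{H}(L')$. Then, with these five maps (the left and right actions $\ast$ and the three ternary maps $\{-,-,-\}$), $L'$ is a module over $L$.
   Context: $\mathbb{K}$ is a field of characteristic different from 2 and $G$ is an abelian group. A bicharacter is a map $\varepsilon:G\times G\to\mathbb{K}^*$ with $\varepsilon(a,b)\varepsilon(b,a)=1$, $\varepsilon(a,b+c)=\varepsilon(a,b)\varepsilon(a,c)$, $\varepsilon(a+b,c)=\varepsilon(a,c)\varepsilon(b,c)$. For a $G$-graded vector space $V=\bigoplus_{a\in G}V_a$ over $\mathbb{K}$, $\mathcal{H}(V)$ denotes the set of homogeneous elements. For homogeneous $x,y,z$ one writes $\varepsilon(x,y)$ for $\varepsilon(\deg x,\deg y)$, $\varepsilon(x,y+z)$ for $\varepsilon(\deg x,\deg y+\deg z)$, etc. A multilinear map is even if the degree of its value on homogeneous elements is the sum of their degrees. A non-commutative ternary Leibniz-Nambu-Poisson color algebra is a quadruple $(A,\cdot,[-,-,-],\varepsilon)$,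 with $A$ a $G$-graded vector space, $\cdot$ even bilinear, $[-,-,-]$ even trilinear and $\varepsilon$ a bicharacter, such that for all $x,y,z,t,u\in\mathcal{H}(A)$: 1) $(x\cdot y)\cdot z=x\cdot(y\cdot z)$; 2) $[[x,y,z],t,u]=[x,y,[z,t,u]]+\varepsilon(z,t+u)[x,[y,t,u],z]+\varepsilon(y+z,t+u)[[x,t,u],y,z]$; 3) $[x\cdot y,z,t]=x\cdot[y,z,t]+\varepsilon(y,z+t)[x,z,t]\cdot y$. A morphism $\alpha:(L,\cdot,[-,-,-],\varepsilon)\to(L',\cdot',[-,-,-]',\varepsilon)$ of such algebras is an even (degree-preserving) linear map with $\alpha(x\cdot y)=\alpha(x)\cdot'\alpha(y)$ and $\alpha([x,y,z])=[\alpha(x),\alpha(y),\alpha(z)]'$ for all $x,y,z\in\mathcal{H}(L)$. A module over a non-commutative ternary Leibniz-Nambu-Poisson color algebra $(A,\cdot,[-,-,-],\varepsilon)$ is a $G$-graded vector space $M$ with even bilinear maps $\prec:M\otimes A\to M$, $\succ:A\otimes M\to M$ and three even trilinear maps, all denoted $[-,-,-]$, $M\otimes A\otimes A\to M$, $A\otimes M\otimes A\to M$, $A\otimes A\otimes M\to M$, such that for all $x,y,z,t\in\mathcal{H}(A)$, $m\in\mathcal{H}(M)$: (a) (bimodule) $x\succ(y\succ m)=(x\cdot y)\succ m$; $(m\prec x)\prec y=m\prec(x\cdot y)$; $x\succ(m\prec y)=(x\succ m)\prec y$; (b) $[[m,x,y],z,t]=[m,x,[y,z,t]]+\varepsilon(y,z+t)[m,[x,z,t],y]+\varepsilon(x+y,z+t)[[m,z,t],x,y]$;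 $[[x,m,y],z,t]=[x,m,[y,z,t]]+\varepsilon(y,z+t)[x,[m,z,t],y]+\varepsilon(m+y,z+t)[[x,z,t],m,y]$; $[[x,y,m],z,t]=[x,y,[m,z,t]]+\varepsilon(m,z+t)[x,[y,z,t],m]+\varepsilon(y+m,z+t)[[x,z,t],y,m]$; $[[x,y,z],m,t]=[x,y,[z,m,t]]+\varepsilon(z,m+t)[x,[y,m,t],z]+\varepsilon(y+z,m+t)[[x,m,t],y,z]$; $[[x,y,z],t,m]=[x,y,[z,t,m]]+\varepsilon(z,t+m)[x,[y,t,m],z]+\varepsilon(y+z,t+m)[[x,t,m],y,z]$; (c) $[m\prec x,y,z]=m\prec[x,y,z]+\varepsilon(x,y+z)[m,y,z]\prec x$; $[x\succ m,y,z]=x\succ[m,y,z]+\varepsilon(m,y+z)[x,y,z]\succ m$; $[x\cdot y,m,z]=x\succ[y,m,z]+\varepsilon(y,m+z)[x,m,z]\prec y$; $[x\cdot y,z,m]=x\succ[y,z,m]+\varepsilon(y,z+m)[x,z,m]\prec y$. In the claim, $x\succ m$ is $x\ast m$ and $m\prec x$ is $m\ast x$. *)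

(* Defs.v *)
From HB Require Import structures.
From mathcomp Require Import all_boot all_order all_algebra.

Set Implicit Arguments.
Unset Strict Implicit.
Unset Printing Implicit Defensive.

Import GRing.Theory.
Local Open Scope ring_scope.

Record bicharacter (K : fieldType) (G : zmodType) := Bicharacter {
  bichar_fun :> G -> G -> K;
  bichar_neq0 : forall a b, bichar_fun a b != 0;
  bichar_skew : forall a b, bichar_fun a b * bichar_fun b a = 1;
  bicharDr : forall a b c,
    bichar_fun a (b + c) = bichar_fun a b * bichar_fun a c;
  bicharDl : forall a b c,
    bichar_fun (a + b) c = bichar_fun a c * bichar_fun b c
}.

(* [gr V a] is the homogeneous component V_a.  The last two fields say that V
   is the internal direct sum of the V_a; G and V may both be infinite. *)
Record gradedSpace (K : fieldType) (G : zmodType) := GradedSpace {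
  graded_sort :> lmodType K;
  gr : G -> {pred graded_sort};
  gr_submod : forall a, submod_closed (gr a);
  gr_span : forall v : graded_sort, exists (s : seq G) (f : G -> graded_sort),
    (forall a, f a \in gr a) /\ v = \sum_(a <- s) f a;
  gr_indep : forall (s : seq G) (f : G -> graded_sort),
    uniq s -> (forall a, f a \in gr a) -> \sum_(a <- s) f a = 0 ->
    forall a, a \in s -> f a = 0
}.
Arguments gr {K G} V a : rename.

Definition homogeneous (K : fieldType) (G : zmodType) (V : gradedSpace K G)
    (x : V) : Prop :=
  exists a, x \in gr V a.

Section Multilinear.
Variables (K : fieldType) (G : zmodType).

Definition bilinear_map (U V W : lmodType K) (f : U -> V -> W) : Prop :=
  (forall v, linear (fun u => f u v)) /\ (forall u, linear (f u)).

Definition trilinear_map (U V W X : lmodType K) (f : U -> V -> W -> X) : Prop :=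
  [/\ forall v w, linear (fun u => f u v w),
      forall u w, linear (fun v => f u v w)
    & forall u v, linear (f u v)].

Definition even1 (U V : gradedSpace K G) (f : U -> V) : Prop :=
  forall a u, u \in gr U a -> f u \in gr V a.

Definition even2 (U V W : gradedSpace K G) (f : U -> V -> W) : Prop :=
  forall a b u v, u \in gr U a -> v \in gr V b -> f u v \in gr W (a + b).

Definition even3 (U V W X : gradedSpace K G) (f : U -> V -> W -> X) : Prop :=
  forall a b c u v w, u \in gr U a -> v \in gr V b -> w \in gr W c ->
    f u v w \in gr X (a + b + c).

End Multilinear.

(* Identities involving the bicharacter are quantified over degrees a, b, ...
   together with x in A_a, y in A_b, ...: a nonzero homogeneous element has
   exactly one degree, and the identities are trivial if one entry is 0. *)

(* Non-commutative ternary Leibniz-Nambu-Poisson color algebras. *)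
Record LNPColorAlgebra (K : fieldType) (G : zmodType) (eps : bicharacter K G) :=
  LNPColorAlgebraPack {
  lnp_sort :> gradedSpace K G;
  lnp_mul : lnp_sort -> lnp_sort -> lnp_sort;
  lnp_br : lnp_sort -> lnp_sort -> lnp_sort -> lnp_sort;
  lnp_mul_bilinear : bilinear_map lnp_mul;
  lnp_mul_even : even2 lnp_mul;
  lnp_br_trilinear : trilinear_map lnp_br;
  lnp_br_even : even3 lnp_br;
  lnp_mulA : forall x y z : lnp_sort,
    homogeneous x -> homogeneous y -> homogeneous z ->
    lnp_mul (lnp_mul x y) z = lnp_mul x (lnp_mul y z);
  lnp_nambu : forall (a b c d e : G) (x y z t u : lnp_sort),
    x \in gr lnp_sort a -> y \in gr lnp_sort b -> z \in gr lnp_sort c ->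
    t \in gr lnp_sort d -> u \in gr lnp_sort e ->
    lnp_br (lnp_br x y z) t u =
      lnp_br x y (lnp_br z t u)
      + eps c (d + e) *: lnp_br x (lnp_br y t u) z
      + eps (b + c) (d + e) *: lnp_br (lnp_br x t u) y z;
  lnp_leibniz : forall (a b c d : G) (x y z t : lnp_sort),
    x \in gr lnp_sort a -> y \in gr lnp_sort b -> z \in gr lnp_sort c ->
    t \in gr lnp_sort d ->
    lnp_br (lnp_mul x y) z t =
      lnp_mul x (lnp_br y z t)
      + eps b (c + d) *: lnp_mul (lnp_br x z t) y
}.
Arguments lnp_mul {K G eps} A x y : rename.
Arguments lnp_br {K G eps} A x y z : rename.

Record LNPMorphism (K : fieldType) (G : zmodType) (eps : bicharacter K G)
    (L L' : LNPColorAlgebra eps) := LNPMorphismPack {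
  lnp_mor :> {linear L -> L'};
  lnp_mor_even : even1 lnp_mor;
  lnp_mor_mul : forall x y : L, homogeneous x -> homogeneous y ->
    lnp_mor (lnp_mul L x y) = lnp_mul L' (lnp_mor x) (lnp_mor y);
  lnp_mor_br : forall x y z : L,
    homogeneous x -> homogeneous y -> homogeneous z ->
    lnp_mor (lnp_br L x y z) =
      lnp_br L' (lnp_mor x) (lnp_mor y) (lnp_mor z)
}.

(* [ract m x] is m < x, [lact x m] is x > m; [brM1], [brM2], [brM3] are the
   three brackets, numbered by the position of the entry taken in M. *)
Record is_LNPModule (K : fieldType) (G : zmodType) (eps : bicharacter K G)
    (A : LNPColorAlgebra eps) (M : gradedSpace K G)
    (ract : M -> A -> M) (lact : A -> M -> M)
    (brM1 : M -> A -> A -> M) (brM2 : A -> M -> A -> M)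
    (brM3 : A -> A -> M -> M) : Prop := IsLNPModule {
  mod_ract_bilinear : bilinear_map ract;
  mod_ract_even : even2 ract;
  mod_lact_bilinear : bilinear_map lact;
  mod_lact_even : even2 lact;
  mod_brM1_trilinear : trilinear_map brM1;
  mod_brM1_even : even3 brM1;
  mod_brM2_trilinear : trilinear_map brM2;
  mod_brM2_even : even3 brM2;
  mod_brM3_trilinear : trilinear_map brM3;
  mod_brM3_even : even3 brM3;

  mod_lactA : forall (x y : A) (m : M),
    homogeneous x -> homogeneous y -> homogeneous m ->
    lact x (lact y m) = lact (lnp_mul A x y) m;
  mod_ractA : forall (x y : A) (m : M),
    homogeneous x -> homogeneous y -> homogeneous m ->
    ract (ract m x) y = ract m (lnp_mul A x y);
  mod_lractA : forall (x y : A) (m : M),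
    homogeneous x -> homogeneous y -> homogeneous m ->
    lact x (ract m y) = ract (lact x m) y;

  mod_nambu1 : forall (a b c d e : G) (x y z t : A) (m : M),
    x \in gr A a -> y \in gr A b -> z \in gr A c -> t \in gr A d ->
    m \in gr M e ->
    brM1 (brM1 m x y) z t =
      brM1 m x (lnp_br A y z t)
      + eps b (c + d) *: brM1 m (lnp_br A x z t) y
      + eps (a + b) (c + d) *: brM1 (brM1 m z t) x y;
  mod_nambu2 : forall (a b c d e : G) (x y z t : A) (m : M),
    x \in gr A a -> y \in gr A b -> z \in gr A c -> t \in gr A d ->
    m \in gr M e ->
    brM1 (brM2 x m y) z t =
      brM2 x m (lnp_br A y z t)
      + eps b (c + d) *: brM2 x (brM1 m z t) y
      + eps (e + b) (c + d) *: brM2 (lnp_br A x z t) m y;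
  mod_nambu3 : forall (a b c d e : G) (x y z t : A) (m : M),
    x \in gr A a -> y \in gr A b -> z \in gr A c -> t \in gr A d ->
    m \in gr M e ->
    brM1 (brM3 x y m) z t =
      brM3 x y (brM1 m z t)
      + eps e (c + d) *: brM3 x (lnp_br A y z t) m
      + eps (b + e) (c + d) *: brM3 (lnp_br A x z t) y m;
  mod_nambu4 : forall (a b c d e : G) (x y z t : A) (m : M),
    x \in gr A a -> y \in gr A b -> z \in gr A c -> t \in gr A d ->
    m \in gr M e ->
    brM2 (lnp_br A x y z) m t =
      brM3 x y (brM2 z m t)
      + eps c (e + d) *: brM2 x (brM2 y m t) z
      + eps (b + c) (e + d) *: brM1 (brM2 x m t) y z;
  mod_nambu5 : forall (a b c d e : G) (x y z t : A) (m : M),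
    x \in gr A a -> y \in gr A b -> z \in gr A c -> t \in gr A d ->
    m \in gr M e ->
    brM3 (lnp_br A x y z) t m =
      brM3 x y (brM3 z t m)
      + eps c (d + e) *: brM2 x (brM3 y t m) z
      + eps (b + c) (d + e) *: brM1 (brM3 x t m) y z;

  mod_leibniz1 : forall (a b c e : G) (x y z : A) (m : M),
    x \in gr A a -> y \in gr A b -> z \in gr A c -> m \in gr M e ->
    brM1 (ract m x) y z =
      ract m (lnp_br A x y z) + eps a (b + c) *: ract (brM1 m y z) x;
  mod_leibniz2 : forall (a b c e : G) (x y z : A) (m : M),
    x \in gr A a -> y \in gr A b -> z \in gr A c -> m \in gr M e ->
    brM1 (lact x m) y z =
      lact x (brM1 m y z) + eps e (b + c) *: lact (lnp_br A x y z) m;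
  mod_leibniz3 : forall (a b c e : G) (x y z : A) (m : M),
    x \in gr A a -> y \in gr A b -> z \in gr A c -> m \in gr M e ->
    brM2 (lnp_mul A x y) m z =
      lact x (brM2 y m z) + eps b (e + c) *: ract (brM2 x m z) y;
  mod_leibniz4 : forall (a b c e : G) (x y z : A) (m : M),
    x \in gr A a -> y \in gr A b -> z \in gr A c -> m \in gr M e ->
    brM3 (lnp_mul A x y) z m =
      lact x (brM3 y z m) + eps b (c + e) *: ract (brM3 x z m) y
}.
Arguments is_LNPModule {K G eps} A M ract lact brM1 brM2 brM3.

(* Main.v *)
Require Import Defs.
From HB Require Import structures.
From mathcomp Require Import all_boot all_order all_algebra.

Set Implicit Arguments.
Unset Strict Implicit.
Unset Printing Implicit Defensive.

Import GRing.Theory.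
Local Open Scope ring_scope.

(** The algebra [L'] is a module over itself: each module axiom is one of the
    three algebra axioms (associativity, the Nambu identity, the Leibniz rule)
    with one entry singled out as the module element.  The five maps of the
    theorem are the operations of [L'] precomposed with the morphism [alpha] in
    the algebra entries.  Linear even maps can be precomposed without losing
    multilinearity or evenness ([bilinear_map_comp], [trilinear_map_comp],
    [even2_comp], [even3_comp]).  As for the identities, [alpha] turns products
    and brackets of [L] into those of [L'], so each module axiom at
    [x, y, z, t, m] becomes an axiom of [L'] at the images of [x, y, z, t] and
    at [m]; since [alpha] preserves degrees, the factors given by the
    bicharacter are the same on both sides. *)

Lemma bilinear_map_comp (K : fieldType) (U V U' V' W : lmodType K)
    (f : U -> V -> W) (g : {linear U' -> U}) (h : {linear V' -> V}) :
  bilinear_map f -> bilinear_map (fun u v => f (g u) (h v)).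
Proof.
by case=> fl fr; split=> [v|u] k x y /=; rewrite linearP; [apply: fl | apply: fr].
Qed.

Lemma trilinear_map_comp (K : fieldType) (U V W U' V' W' X : lmodType K)
    (f : U -> V -> W -> X)
    (g : {linear U' -> U}) (h : {linear V' -> V}) (k : {linear W' -> W}) :
  trilinear_map f -> trilinear_map (fun u v w => f (g u) (h v) (k w)).
Proof.
case=> f1 f2 f3; split=> [v w|u w|u v] c x y /=; rewrite linearP.
- exact: f1.
- exact: f2.
- exact: f3.
Qed.

Lemma even2_comp (K : fieldType) (G : zmodType) (U V U' V' W : gradedSpace K G)
    (f : U -> V -> W) (g : U' -> U) (h : V' -> V) :
  even1 g -> even1 h -> even2 f -> even2 (fun u v => f (g u) (h v)).
Proof. by move=> eg eh ef a b u v /eg ua /eh vb; apply: ef. Qed.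

Lemma even3_comp (K : fieldType) (G : zmodType)
    (U V W U' V' W' X : gradedSpace K G) (f : U -> V -> W -> X)
    (g : U' -> U) (h : V' -> V) (k : W' -> W) :
  even1 g -> even1 h -> even1 k -> even3 f ->
  even3 (fun u v w => f (g u) (h v) (k w)).
Proof.
by move=> eg eh ek ef a b c u v w /eg ua /eh vb /ek wc; apply: ef.
Qed.

(** Evenness of the identity serves for the module entry, which is not moved by
    the morphism. *)
Lemma even1_idfun (K : fieldType) (G : zmodType) (V : gradedSpace K G) :
  even1 (@idfun V).
Proof. by []. Qed.

Lemma gr_homogeneous (K : fieldType) (G : zmodType) (V : gradedSpace K G)
    (a : G) (x : V) :
  x \in gr V a -> homogeneous x.
Proof. by exists a. Qed.

Section Morphism.

Variables (K : fieldType) (G : zmodType) (eps : bicharacter K G).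
Variables (L L' : LNPColorAlgebra eps) (alpha : LNPMorphism L L').

Lemma mor_gr (a : G) (x : L) : x \in gr L a -> alpha x \in gr L' a.
Proof. exact: lnp_mor_even. Qed.

Lemma mor_homogeneous (x : L) : homogeneous x -> homogeneous (alpha x).
Proof. by case=> a xa; exists a; apply: mor_gr. Qed.

Lemma mor_mul_gr (a b : G) (x y : L) : x \in gr L a -> y \in gr L b ->
  alpha (lnp_mul L x y) = lnp_mul L' (alpha x) (alpha y).
Proof.
by move=> xa yb; apply: lnp_mor_mul; apply: gr_homogeneous; eassumption.
Qed.

Lemma mor_br_gr (a b c : G) (x y z : L) :
  x \in gr L a -> y \in gr L b -> z \in gr L c ->
  alpha (lnp_br L x y z) = lnp_br L' (alpha x) (alpha y) (alpha z).
Proof.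
by move=> xa yb zc; apply: lnp_mor_br; apply: gr_homogeneous; eassumption.
Qed.

End Morphism.

Theorem theorem4p16 (K : fieldType) (charK : 2%N \notin [pchar K])
    (G : zmodType) (eps : bicharacter K G) (L L' : LNPColorAlgebra eps)
    (alpha : LNPMorphism L L') :
  is_LNPModule L L'
    (fun (m : L') (x : L) => lnp_mul L' m (alpha x))
    (fun (x : L) (m : L') => lnp_mul L' (alpha x) m)
    (fun (m : L') (x y : L) => lnp_br L' m (alpha x) (alpha y))
    (fun (x : L) (m : L') (y : L) => lnp_br L' (alpha x) m (alpha y))
    (fun (x y : L) (m : L') => lnp_br L' (alpha x) (alpha y) m).
Proof.
have id_even := @even1_idfun _ _ L'.
have alpha_even := lnp_mor_even alpha.
have mul_bil := lnp_mul_bilinear L'; have mul_even := @lnp_mul_even _ _ _ L'.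
have br_tri := lnp_br_trilinear L'; have br_even := @lnp_br_even _ _ _ L'.
split.
- exact: (bilinear_map_comp idfun alpha mul_bil).
- exact: (even2_comp id_even alpha_even mul_even).
- exact: (bilinear_map_comp alpha idfun mul_bil).
- exact: (even2_comp alpha_even id_even mul_even).
- exact: (trilinear_map_comp idfun alpha alpha br_tri).
- exact: (even3_comp id_even alpha_even alpha_even br_even).
- exact: (trilinear_map_comp alpha idfun alpha br_tri).
- exact: (even3_comp alpha_even id_even alpha_even br_even).
- exact: (trilinear_map_comp alpha alpha idfun br_tri).
- exact: (even3_comp alpha_even alpha_even id_even br_even).
- move=> x y m hx hy hm; rewrite lnp_mor_mul // lnp_mulA //;
    exact: mor_homogeneous.
- move=> x y m hx hy hm; rewrite lnp_mor_mul // lnp_mulA //;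
    exact: mor_homogeneous.
- move=> x y m hx hy hm; rewrite lnp_mulA //; exact: mor_homogeneous.
- move=> a b c d e x y z t m xa yb zc td me.
  rewrite (mor_br_gr alpha yb zc td).
  rewrite (mor_br_gr alpha xa zc td).
  exact: (lnp_nambu me (mor_gr alpha xa) (mor_gr alpha yb) (mor_gr alpha zc)
           (mor_gr alpha td)).
- move=> a b c d e x y z t m xa yb zc td me.
  rewrite (mor_br_gr alpha yb zc td).
  rewrite (mor_br_gr alpha xa zc td).
  exact: (lnp_nambu (mor_gr alpha xa) me (mor_gr alpha yb) (mor_gr alpha zc)
           (mor_gr alpha td)).
- move=> a b c d e x y z t m xa yb zc td me.
  rewrite (mor_br_gr alpha yb zc td).
  rewrite (mor_br_gr alpha xa zc td).
  exact: (lnp_nambu (mor_gr alpha xa) (mor_gr alpha yb) me (mor_gr alpha zc)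
           (mor_gr alpha td)).
- move=> a b c d e x y z t m xa yb zc td me.
  rewrite (mor_br_gr alpha xa yb zc).
  exact: (lnp_nambu (mor_gr alpha xa) (mor_gr alpha yb) (mor_gr alpha zc) me
           (mor_gr alpha td)).
- move=> a b c d e x y z t m xa yb zc td me.
  rewrite (mor_br_gr alpha xa yb zc).
  exact: (lnp_nambu (mor_gr alpha xa) (mor_gr alpha yb) (mor_gr alpha zc)
           (mor_gr alpha td) me).
- move=> a b c e x y z m xa yb zc me.
  rewrite (mor_br_gr alpha xa yb zc).
  exact: (lnp_leibniz me (mor_gr alpha xa) (mor_gr alpha yb) (mor_gr alpha zc)).
- move=> a b c e x y z m xa yb zc me.
  rewrite (mor_br_gr alpha xa yb zc).
  exact: (lnp_leibniz (mor_gr alpha xa) me (mor_gr alpha yb) (mor_gr alpha zc)).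
- move=> a b c e x y z m xa yb zc me.
  rewrite (mor_mul_gr alpha xa yb).
  exact: (lnp_leibniz (mor_gr alpha xa) (mor_gr alpha yb) me (mor_gr alpha zc)).
- move=> a b c e x y z m xa yb zc me.
  rewrite (mor_mul_gr alpha xa yb).
  exact: (lnp_leibniz (mor_gr alpha xa) (mor_gr alpha yb) (mor_gr alpha zc) me).
Qed.
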